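(* The equivalence relation $\sim$ on $\mathscr{X}$ is coanalytic; that is, the set $\{(x,y)\in\mathscr{X}^2 : x\sim y\}$ is a coanalytic subset of $\mathscr{X}^2$ (equivalently, $\{(x,y)\in\mathscr{X}^2 : x\not\sim y\}$ is an analytic subset of $\mathscr{X}^2$).
   Context: $\mathbf{N}$ denotes the set of positive integers. $\mathscr{X}$ is the set of all sequences $x=(x_n)_{n\in\mathbf{N}}$ of strictly positive real numbers such that $\sum_n x_n=\infty$. It is endowed with the subspace topology inherited from $\mathbf{R}^{\mathbf{N}}$ with the product topology, for which it is a Polish space, and $\mathscr{X}^2$ carries the product topology. For $x\in\mathscr{X}$, let $\mathcal{I}_x:=\{A\subseteq\mathbf{N} : \sum_{n\in A}x_n<\infty\}$. For $x,y\in\mathscr{X}$, write $x\sim y$ if $\mathcal{I}_x=\mathcal{I}_y$, i.e., if for all $A\subseteq\mathbf{N}$, $\sum_{n\in A}x_n<\infty$ if and only if $\sum_{n\in A}y_n<\infty$. A subset of a Polish space is analytic if it is a continuous image of a Polish space (or empty), and coanalytic if its complement is analytic. *)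

(* Defs.v *)
From HB Require Import structures.
From mathcomp Require Import all_boot all_order all_algebra.
From mathcomp Require Import all_classical all_reals all_analysis.

Set Implicit Arguments.
Unset Strict Implicit.
Unset Printing Implicit Defensive.

Import Order.TTheory GRing.Theory Num.Theory.
Import numFieldNormedType.Exports.

Local Open Scope classical_set_scope.
Local Open Scope ring_scope.

(* Completeness in the sense of the library's mixin Uniform_isComplete, which
   is not used itself because it applies only to pointed (hence nonempty)
   spaces. *)
Definition complete_space (M : uniformType) : Prop :=
  forall F : set_system M, ProperFilter F -> cauchy F -> exists l : M, F --> l.

Definition homeomorphic (S T : topologicalType) : Prop :=
  exists (f : S -> T) (g : T -> S),
    [/\ cancel f g, cancel g f, continuous f & continuous g].

Definition separable (T : topologicalType) : Prop :=
  exists2 D : set T, countable D & dense D.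

Definition completely_metrizable (R : realType) (T : topologicalType) : Prop :=
  exists2 M : metricType R, complete_space M & homeomorphic T M.

Definition polish (R : realType) (T : topologicalType) : Prop :=
  separable T /\ completely_metrizable R T.

(* The field R only serves as the set of values of metrics. *)
Definition analytic (R : realType) (T : topologicalType) (A : set T) : Prop :=
  A = set0 \/
  exists (P : topologicalType) (f : P -> T),
    [/\ polish R P, continuous f & range f = A].

Definition coanalytic (R : realType) (T : topologicalType) (A : set T) : Prop :=
  analytic R (~` A).

(* Sequences are indexed by nat instead of the positive integers; x n is the
   term of index n + 1.  As a type, divergent_seqs R carries the topology
   induced by the product topology of {ptws nat -> R}. *)
Definition divergent_seqs (R : realType) : set {ptws nat -> R} :=
  [set x : {ptws nat -> R} | (forall n, 0 < x n) /\
     (\esum_(n in [set: nat]) (x n)%:E = +oo)%E].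
Arguments divergent_seqs : clear implicits.

Definition summable_ideal (R : realType) (x : nat -> R) : set (set nat) :=
  [set A | (\esum_(n in A) (x n)%:E < +oo)%E].

Definition ideal_equiv (R : realType) (x y : divergent_seqs R) : Prop :=
  summable_ideal (val x) = summable_ideal (val y).

(* Main.v *)
(* The sequences x and y are inequivalent iff some A is in exactly one of the two
   ideals. Positivity of the terms, divergence of a series and boundedness of its
   partial sums all become closed conditions once a sequence m of sufficiently
   large reals is supplied as a witness; with the indicator a of A, the tuples
   (x, y, a, m) thus form a closed subset of R^N. Closed subsets of R^N are
   Polish, for the metric sup_n min(|p n - q n|, 1/(n+1)), and the inequivalent
   pairs are the image of this one under the projection to (x, y). *)
Require Import Defs.
From HB Require Import structures.
From mathcomp Require Import all_boot all_order all_algebra.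
From mathcomp Require Import all_classical all_reals all_analysis.
From mathcomp Require Import lra.

Set Implicit Arguments.
Unset Strict Implicit.
Unset Printing Implicit Defensive.

Import Order.TTheory GRing.Theory Num.Theory.
Import numFieldNormedType.Exports.

Local Open Scope classical_set_scope.
Local Open Scope ring_scope.

(** * A bounded metric on sequences, with the cap 1/(n+1) on coordinate n *)

Section SequenceMetric.
Variable R : realType.
Implicit Types (p q : nat -> R) (n : nat) (e : R).

Definition coord_dist p q n : R := Num.min `|p n - q n| n.+1%:R^-1.

Definition seq_dist p q : R := sup (range (coord_dist p q)).

Lemma coord_dist_le_seq_dist p q n : coord_dist p q n <= seq_dist p q.
Proof.
apply: ub_le_sup; last by exists n.
exists 1 => _ [k _ <-]; rewrite ge_min; apply/orP; right.
by rewrite invf_le1// ler1n.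
Qed.

Lemma seq_dist_le p q e :
  (forall n, coord_dist p q n <= e) -> seq_dist p q <= e.
Proof.
move=> le_e; apply: ge_sup; first by exists (coord_dist p q 0%N), 0%N.
by move=> _ [n _ <-].
Qed.

(** A distance below the cap of coordinate n leaves [|p n - q n|] as the smaller term of the
    minimum. *)
Lemma coord_lt_of_seq_dist p q n e :
  e <= n.+1%:R^-1 -> seq_dist p q < e -> `|p n - q n| < e.
Proof.
move=> en pqe; have := le_lt_trans (coord_dist_le_seq_dist p q n) pqe.
by rewrite gt_min => /orP[//|/lt_le_trans/(_ en)]; rewrite ltxx.
Qed.

(** From index [Num.truncn e^-1] on, the cap 1/(n+1) is already at most e, so only finitely many
    coordinates need control. *)
Lemma seq_dist_le_of_coords p q e : 0 < e ->
  (forall n, (n < Num.truncn e^-1)%N -> `|p n - q n| <= e) -> seq_dist p q <= e.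
Proof.
move=> e0 pqe; apply: seq_dist_le => n; rewrite ge_min.
have [/pqe ->//|en] := ltnP n (Num.truncn e^-1).
apply/orP; right; rewrite -[leRHS]invrK lef_pV2 ?posrE ?invr_gt0 ?ltr0n//.
by rewrite ltW// (lt_le_trans (truncnS_gt _))// ler_nat.
Qed.

Lemma seq_distxx p : seq_dist p p = 0.
Proof.
apply/eqP; rewrite eq_le; apply/andP; split.
  by apply: seq_dist_le => n; rewrite /coord_dist subrr normr0 ge_min lexx.
apply: le_trans _ (coord_dist_le_seq_dist p p 0%N).
by rewrite /coord_dist le_min normr_ge0 invr_ge0 ler0n.
Qed.

Lemma seq_dist_eq0 p q : seq_dist p q = 0 -> p = q.
Proof.
move=> pq0; apply/funext => n; apply/eqP; rewrite -subr_eq0 -normr_le0.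
have := coord_dist_le_seq_dist p q n.
by rewrite pq0 ge_min => /orP[//|]; rewrite leNgt invr_gt0 ltr0n.
Qed.

Lemma seq_distC p q : seq_dist p q = seq_dist q p.
Proof.
suff pqE : coord_dist p q = coord_dist q p by rewrite /seq_dist pqE.
by apply/funext => n; rewrite /coord_dist distrC.
Qed.

Lemma seq_dist_triangle q p r :
  seq_dist p r <= seq_dist p q + seq_dist q r.
Proof.
apply: seq_dist_le => n.
apply: le_trans _ (lerD (coord_dist_le_seq_dist p q n)
                        (coord_dist_le_seq_dist q r n)).
rewrite /coord_dist.
have := ler_distD (q n) (p n) (r n).
have : 0 < n.+1%:R^-1 :> R by rewrite invr_gt0 ltr0n.
have := normr_ge0 (p n - q n); have := normr_ge0 (q n - r n).
move: `|p n - r n| `|p n - q n| `|q n - r n| n.+1%:R^-1 => a b c d.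
by rewrite /Num.min => *; do 3 case: ltP => ?; lra.
Qed.

End SequenceMetric.

(** * Closed subspaces of R^N are Polish *)

Section ClosedSubspace.
Variables (R : realType) (K : set {ptws nat -> R}).

(** A second name for the points of K: it carries the metric, while [set_type K] keeps the subspace
    topology. The identity maps in both directions will be shown continuous. *)
Definition seq_subspace : Type := set_type K.

HB.instance Definition _ := Choice.on seq_subspace.

Let dist (p q : seq_subspace) : R := seq_dist (val p) (val q).

Let distxx p : dist p p = 0. Proof. exact: seq_distxx. Qed.

Let dist_eq0 p q : dist p q = 0 -> p = q.
Proof. by move=> /seq_dist_eq0; exact: val_inj. Qed.

Let distC p q : dist p q = dist q p. Proof. exact: seq_distC. Qed.

Let dist_triangle q p r : dist p r <= dist p q + dist q r.
Proof. exact: seq_dist_triangle. Qed.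

HB.instance Definition _ :=
  isMetric.Build R seq_subspace distxx dist_eq0 distC dist_triangle.

Lemma seq_subspace_ball (p q : seq_subspace) e :
  ball p e q <-> seq_dist (val p) (val q) < e.
Proof. by rewrite ballEmdist. Qed.

Lemma seq_subspace_ball_coord n e : 0 < e ->
  exists2 d, 0 < d & forall p q : seq_subspace, ball p d q ->
    `|(val p : nat -> R) n - (val q : nat -> R) n| < e.
Proof.
move=> e0; exists (Num.min e n.+1%:R^-1).
  by rewrite lt_min e0 invr_gt0 ltr0n.
move=> p q /seq_subspace_ball pq.
have /coord_lt_of_seq_dist/(_ pq)/lt_le_trans : Num.min e n.+1%:R^-1 <= n.+1%:R^-1.
  by rewrite ge_min lexx orbT.
by apply; rewrite ge_min lexx.
Qed.

Lemma coord_continuous n : continuous (fun p : set_type K => val p n).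
Proof.
move=> p; apply: (@cvg_comp _ _ _ val (fun q : {ptws nat -> R} => q n) _
  (nbhs (val p : {ptws nat -> R}))).
  exact: (@initial_continuous (set_type K) {ptws nat -> R} set_val p).
exact: (@proj_continuous nat (fun=> R) n (val p)).
Qed.

Lemma continuous_to_seq_subspace : continuous (id : set_type K -> seq_subspace).
Proof.
move=> p; apply/(cvg_ballP _ _ (FF := nbhs_filter p)) => e e0.
(* Halving e makes up for the non-strict bound of [seq_dist_le_of_coords]. *)
pose N := Num.truncn (e / 2)^-1.
have : nbhs p [set q : set_type K |
    forall i : 'I_N, `|(val p : nat -> R) i - (val q : nat -> R) i| < e / 2].
  apply: (@filter_forall _ _ (fun (i : 'I_N) (q : set_type K) =>
    `|(val p : nat -> R) i - (val q : nat -> R) i| < e / 2) _ (nbhs_filter p)) => i.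
  have /(cvgrPdist_lt (FF := nbhs_filter p)) := @coord_continuous i p.
  by apply; rewrite divr_gt0.
apply: filterS => q pq; apply/seq_subspace_ball.
apply: (@le_lt_trans _ _ (e / 2)); last by rewrite ltr_pdivrMr// ltr_pMr// ltr1n.
apply: seq_dist_le_of_coords => [|n nN]; first by rewrite divr_gt0.
exact: ltW (pq (Ordinal nN)).
Qed.

Lemma continuous_of_seq_subspace : continuous (id : seq_subspace -> set_type K).
Proof.
apply: continuous_comp_initial => p.
apply/(pointwise_cvgP _ (fmap_filter (val : seq_subspace -> nat -> R)
  (nbhs_filter p))) => n.
apply/(cvgrPdist_lt _ _ (FF := fmap_filter (val : seq_subspace -> nat -> R)
  (nbhs_filter p))) => e e0 /=.
have [d d0 dE] := seq_subspace_ball_coord n e0.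
have : nbhs p (ball p d) by exact: nbhsx_ballx.
by apply: filterS => q /dE.
Qed.

Lemma complete_seq_subspace : closed K -> complete_space seq_subspace.
Proof.
move=> clK F PF /cauchyP cF.
pose coord n (p : seq_subspace) : R := val p n.
have coord_cvg n : cvg (coord n @ F).
  apply: R_complete; apply/cauchyP => e e0.
  have [d d0 dE] := seq_subspace_ball_coord n e0.
  have [p Fp] := cF _ d0; exists (coord n p).
  by apply: (filterS (P := ball p d) _ Fp) => q; exact: dE.
(* The limit is built coordinatewise by completeness of R; closedness of K then puts it in K. *)
pose l : {ptws nat -> R} := fun n => lim (coord n @ F).
have Fl : (val : seq_subspace -> {ptws nat -> R}) @ F --> l.
  by apply/pointwise_cvgP => n; exact: coord_cvg.
have Kl : K l.
  apply: (closed_cvg K clK _ _ Fl).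
  by apply: nearW => p; exact: set_valP.
pose L : set_type K := SigSub (mem_set Kl).
have FL : F --> L.
  move=> A [_ [[B oB <-]] BL] BA; apply: filterS BA _.
  by apply: Fl; exact: open_nbhs_nbhs.
exists L; exact: cvg_comp FL (@continuous_to_seq_subspace L).
Qed.

(** Finite rational prefixes need not come from points of K, so each prefix with a precision selects
    a nearby point of K when there is one, and [p0] otherwise. *)
Lemma separable_seq_subspace : separable (set_type K).
Proof.
have [[p0 _]|noK] := pselect (exists p : set_type K, True); last first.
  exists set0; first exact: countable0.
  by move=> O [p _]; absurd False => //; apply: noK; exists p.
pose pick (c : seq rat * nat) : set_type K := xget p0
  [set p | forall n, (n < size c.1)%N ->
     `|(val p : nat -> R) n - ratr (nth 0 c.1 n)| < c.2.+1%:R^-1].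
exists (range pick).
  exact: (card_le_trans (card_image_le _ _)) (countableP _).
move=> O [p Op] oO.
have : nbhs (p : seq_subspace) O.
  by apply: continuous_of_seq_subspace; exact: open_nbhs_nbhs.
move=> /nbhs_ballP[e /= e0 eO].
(* On the first N coordinates, p and the selected point are each within e/4 of the same rationals,
   hence within e/2 of each other. *)
pose N := Num.truncn (e / 2)^-1; pose j := Num.truncn (e / 4)^-1.
have j0 : 0 < j.+1%:R^-1 :> R by rewrite invr_gt0.
have je : j.+1%:R^-1 <= e / 4.
  rewrite -[leRHS]invrK lef_pV2 ?posrE ?invr_gt0 ?divr_gt0//.
  exact/ltW/truncnS_gt.
have approx n : exists q : rat, `|(val p : nat -> R) n - ratr q| < j.+1%:R^-1.
  have : (val p : nat -> R) n - j.+1%:R^-1 < (val p : nat -> R) n.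
    by rewrite ltrBlDr ltrDl.
  move=> /rat_in_itvoo[q]; rewrite in_itv/= => /andP[lq qu].
  by exists q; rewrite ger0_norm ?subr_ge0 ?(ltW qu)// ltrBlDr addrC -ltrBlDr.
pose q n := sval (cid (approx n)).
have qE n : `|(val p : nat -> R) n - ratr (q n)| < j.+1%:R^-1.
  exact: svalP (cid (approx n)).
exists (pick (mkseq q N, j)); split; last by exists (mkseq q N, j).
have pickE n : (n < N)%N ->
    `|(val (pick (mkseq q N, j)) : nat -> R) n - ratr (q n)| < j.+1%:R^-1.
  move=> nN; rewrite /pick; case: xgetP => [r _ /= /(_ n)|/(_ p)].
    by rewrite size_mkseq nth_mkseq// => /(_ nN).
  (* The default is not taken here, since p itself matches the prefix. *)
  move=> noq; exfalso; apply: noq => i /=; rewrite size_mkseq => iN.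
  by rewrite nth_mkseq ?qE.
apply: eO; apply/seq_subspace_ball.
apply: (@le_lt_trans _ _ (e / 2)); last by rewrite ltr_pdivrMr// ltr_pMr// ltr1n.
apply: seq_dist_le_of_coords => [|n nN]; first by rewrite divr_gt0.
rewrite (le_trans (ler_distD (ratr (q n)) _ _))//.
have -> : e / 2 = e / 4 + e / 4 by lra.
by rewrite lerD// (le_trans _ je)// ltW// distrC pickE.
Qed.

Lemma polish_closed_subspace : closed K -> polish R (set_type K).
Proof.
move=> clK; split; first exact: separable_seq_subspace.
exists seq_subspace; first exact: complete_seq_subspace.
exists id, id; split => //.
  exact: continuous_to_seq_subspace.
exact: continuous_of_seq_subspace.
Qed.

End ClosedSubspace.

(** * Real-valued witnesses for convergence, divergence and inequivalence *)

Section Witnesses.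
Variable R : realType.
Implicit Types (u v w x y a m : nat -> R) (A : set nat).

(** With nonnegative terms, the sum over A is the increasing limit of the partial sums weighted by
    the indicator of A. *)
Lemma esum_ltyP A u : (forall n, 0 <= u n) ->
  (\esum_(n in A) (u n)%:E < +oo)%E <->
  exists M, forall N, \sum_(i < N) \1_A i * u i <= M.
Proof.
move=> u0.
have au0 n : 0 <= \1_A n * u n by rewrite mulr_ge0.
have -> : (\esum_(n in A) (u n)%:E = \sum_(n <oo) (\1_A n * u n)%:E)%E.
  rewrite nneseries_esumT => [|n]; last by rewrite lee_fin.
  rewrite esum_mkcond; apply: eq_esum => n _.
  by rewrite indicE; case: ifPn => _; rewrite ?mul1r ?mul0r.
have sumE N : (\sum_(0 <= n < N) (\1_A n * u n)%:E =
    (\sum_(i < N) \1_A i * u i)%:E)%E by rewrite sumEFin big_mkord.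
split=> [sumlty|[M uM]].
  exists (fine (\sum_(n <oo) (\1_A n * u n)%:E)%E) => N.
  rewrite -lee_fin fineK; last first.
    by rewrite ge0_fin_numE// nneseries_ge0// => n _ _; rewrite lee_fin.
  by rewrite -sumE; apply: nneseries_lim_ge => n _ _; rewrite lee_fin.
apply: (@le_lt_trans _ _ M%:E); last exact: ltry.
apply: lime_le; first by apply: is_cvg_nneseries => n _ _; rewrite lee_fin.
by apply: nearW => N; rewrite sumE lee_fin.
Qed.

(* Implies divergence of the series of w for every real-valued m. The
   disjunction of non-strict inequalities, in place of [m k < N -> _], makes the
   condition closed in (m, w) without requiring m to be integer-valued. *)
Definition diverges_at_rate m w :=
  forall k N : nat, N%:R <= m k \/ k%:R <= \sum_(i < N) w i.

(** Lets several witnesses be merged into their pointwise maximum. *)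
Lemma diverges_at_rate_le m m' w : (forall k, m k <= m' k) ->
  diverges_at_rate m w -> diverges_at_rate m' w.
Proof.
by move=> mm' mw k N; have [/le_trans|] := mw k N; [left; auto | right].
Qed.

Lemma esum_eqyP A u : (forall n, 0 <= u n) ->
  (\esum_(n in A) (u n)%:E = +oo)%E <->
  exists m, diverges_at_rate m (fun i => \1_A i * u i).
Proof.
move=> u0; split=> [sumy|[m um]].
  have large (k : nat) : exists N, k%:R < \sum_(i < N) \1_A i * u i.
    apply/not_existsP => small.
    suff : (\esum_(n in A) (u n)%:E < +oo)%E by rewrite sumy ltxx.
    apply/esum_ltyP => //; exists k%:R => N.
    by rewrite leNgt; apply/negP.
  (* [m k] is an index at which the partial sum exceeds k; later partial sums are no smaller. *)
  exists (fun k => (sval (cid (large k)))%:R) => k N; rewrite ler_nat.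
  case: cid => N0 /= kN0; have [NN0|/ltnW N0N] := leqP N N0; first by left.
  right; rewrite (le_trans (ltW kN0))// -(subnKC N0N) big_split_ord/= lerDl.
  by apply: sumr_ge0 => i _; rewrite mulr_ge0.
apply/eqP; rewrite eq_le leey/= leNgt; apply/negP => /esum_ltyP[//|M uM].
(* Here k > M and N > [m k], so the partial sum up to N would exceed its bound M. *)
pose k := (Num.truncn M).+1; pose N := (Num.truncn (m k)).+1.
have [|kN] := um k N; first by rewrite leNgt truncnS_gt.
by have := lt_le_trans (truncnS_gt M) (le_trans kN (uM N)); rewrite ltxx.
Qed.

(* a is the indicator of a set A in I_x but not in I_y; the value m 0 serves as
   a bound for the partial sums of x over A. *)
Definition separates x y a m :=
  (forall N, \sum_(i < N) a i * x i <= m 0%N) /\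
  diverges_at_rate m (fun i => a i * y i).

(* [1 <= m n * x n] turns the open condition [0 < x n] into a closed one. *)
Definition inequiv_witness x y a m :=
  [/\ forall n, a n = 0 \/ a n = 1,
      forall n, (0 <= x n /\ 1 <= m n * x n) /\ (0 <= y n /\ 1 <= m n * y n),
      diverges_at_rate m x /\ diverges_at_rate m y &
      separates x y a m \/ separates y x a m].

Lemma separates_idealP u v : (forall n, 0 <= u n) -> (forall n, 0 <= v n) ->
  (exists2 A, summable_ideal u A & ~ summable_ideal v A) <->
  exists a m, (forall n, a n = 0 \/ a n = 1) /\ separates u v a m.
Proof.
move=> u0 v0; split.
  move=> [A /esum_ltyP[//|M uM] vA].
  have /esum_eqyP[//|m vm] : (\esum_(n in A) (v n)%:E = +oo)%E.
    by apply/eqP; rewrite -leye_eq leNgt; apply/negP.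
  (* The maximum makes entry 0 a bound for the partial sums of u and keeps a divergence rate for
     v. *)
  exists \1_A, (fun k => Num.max M (m k)); split=> [n|].
    by rewrite indicE; case: (_ \in _); [right|left].
  split=> [N|]; first by rewrite le_max uM.
  by apply: diverges_at_rate_le vm => k; rewrite le_max lexx orbT.
move=> [a [m [a01 [ua va]]]].
have aE : a = \1_[set n | a n = 1].
  apply/funext => n; rewrite indicE; have [an|an] := a01 n; last first.
    by rewrite mem_set.
  by rewrite memNset ?an//= an => /esym/eqP; rewrite oner_eq0.
exists [set n | a n = 1].
  by apply/esum_ltyP => //; exists (m 0%N) => N; rewrite -aE.
rewrite /summable_ideal/=; suff -> : (\esum_(n in [set n | a n = 1%R]) (v n)%:E = +oo)%E.
  by rewrite ltxx.
by apply/esum_eqyP => //; exists m; rewrite -aE.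
Qed.

Lemma divergent_seqsP w : (forall n, 0 < w n) ->
  divergent_seqs R w <-> exists m, diverges_at_rate m w.
Proof.
move=> w0; have w1 : (fun i => \1_[set: nat] i * w i) = w.
  by apply/funext => i; rewrite indicT mul1r.
have := esum_eqyP setT (fun n => ltW (w0 n)); rewrite w1 => wE.
by split=> [[_ /wE]|/wE].
Qed.

End Witnesses.

(** * The witness conditions are closed in continuous parameters *)

Section ClosedConditions.
Variables (R : realType) (T : topologicalType).
Implicit Types f g : T -> R.

Lemma closed_forall (I : Type) (P : I -> T -> Prop) :
  (forall i, closed [set t | P i t]) -> closed [set t | forall i, P i t].
Proof.
move=> Pcl; rewrite (_ : [set t | _] = \bigcap_i [set t | P i t]).
  exact: closed_bigI.
by apply/seteqP; split=> [t Pt i _|t Pt i]; exact: Pt.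
Qed.

Lemma closed_le_fun f g : continuous f -> continuous g ->
  closed [set t | f t <= g t].
Proof.
move=> cf cg.
rewrite (_ : [set t | _] = (fun t => g t - f t) @^-1` [set r | 0 <= r]).
  apply: preimage_closed; last exact: closed_ge.
  by move=> t _; apply: cvgB; [exact: cg | exact: cf].
by apply/seteqP; split=> t /=; rewrite subr_ge0.
Qed.

Lemma closed_eq_cst f c : continuous f -> closed [set t | f t = c].
Proof.
by move=> cf; apply: (@preimage_closed _ _ f [set c]) => [t _|];
  [exact: cf | exact: closed_eq].
Qed.

Lemma continuous_sum_ord N (F : nat -> T -> R) :
  (forall i, continuous (F i)) -> continuous (fun t => \sum_(i < N) F i t).
Proof.
by move=> cF; apply: continuous_big => [|i _]; [exact: add_continuous | exact: cF].
Qed.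

Lemma continuous_mul f g : continuous f -> continuous g ->
  continuous (fun t => f t * g t).
Proof. by move=> cf cg t; apply: cvgM; [exact: cf | exact: cg]. Qed.

Lemma closed_diverges_at_rate (m w : nat -> T -> R) :
  (forall n, continuous (m n)) -> (forall n, continuous (w n)) ->
  closed [set t | diverges_at_rate (m^~ t) (w^~ t)].
Proof.
move=> cm cw; apply: closed_forall => k; apply: closed_forall => N.
apply: closedU; apply: closed_le_fun => //; try exact: cst_continuous.
exact: continuous_sum_ord.
Qed.

Lemma closed_separates (x y a m : nat -> T -> R) :
  (forall n, continuous (x n)) -> (forall n, continuous (y n)) ->
  (forall n, continuous (a n)) -> (forall n, continuous (m n)) ->
  closed [set t | separates (x^~ t) (y^~ t) (a^~ t) (m^~ t)].
Proof.
move=> cx cy ca cm; apply: closedI.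
  apply: closed_forall => N; apply: closed_le_fun => //.
  by apply: (@continuous_sum_ord _ (fun i t => a i t * x i t)) => i; exact: continuous_mul.
apply: (@closed_diverges_at_rate m (fun i t => a i t * y i t)) => // i.
exact: continuous_mul.
Qed.

Lemma closed_inequiv_witness (x y a m : nat -> T -> R) :
  (forall n, continuous (x n)) -> (forall n, continuous (y n)) ->
  (forall n, continuous (a n)) -> (forall n, continuous (m n)) ->
  closed [set t | inequiv_witness (x^~ t) (y^~ t) (a^~ t) (m^~ t)].
Proof.
move=> cx cy ca cm.
rewrite (_ : [set t | _] =
    [set t | forall n, a n t = 0 \/ a n t = 1] `&`
    [set t | forall n, (0 <= x n t /\ 1 <= m n t * x n t) /\
                       (0 <= y n t /\ 1 <= m n t * y n t)] `&`
    [set t | diverges_at_rate (m^~ t) (x^~ t) /\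
             diverges_at_rate (m^~ t) (y^~ t)] `&`
    [set t | separates (x^~ t) (y^~ t) (a^~ t) (m^~ t) \/
             separates (y^~ t) (x^~ t) (a^~ t) (m^~ t)]); last first.
  by apply/seteqP; split=> [t [*]|t [[[? ?] ?] ?]]; split.
repeat apply: closedI.
- by apply: closed_forall => n; apply: closedU; exact: closed_eq_cst.
- by apply: closed_forall => n; do 2 apply: closedI; apply: closed_le_fun;
    do ?[exact: cst_continuous | exact: continuous_mul | exact: cx | exact: cy].
- exact: closed_diverges_at_rate.
- exact: closed_diverges_at_rate.
- by apply: closedU; exact: closed_separates.
Qed.

End ClosedConditions.

(** * Coding witness tuples as single sequences, and decoding x and y *)

Section Coding.
Variable R : realType.

(* A point of R^N encodes a double sequence; rows 0, 1, 2, 3 hold x, y, a, m. *)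
Definition entry (c n : nat) (p : {ptws nat -> R}) : R := p (pickle (c, n)).

(** The value 0 fills the indices that code no pair. *)
Definition interleave (s : nat -> nat -> R) : {ptws nat -> R} :=
  fun j => if (unpickle j : option (nat * nat)) is Some (c, n) then s c n else 0.

Lemma entry_interleave s c n : entry c n (interleave s) = s c n.
Proof. by rewrite /entry /interleave pickleK. Qed.

Lemma entry_continuous c n : continuous (entry c n).
Proof. exact: (@proj_continuous nat (fun=> R) (pickle (c, n))). Qed.

Definition coded_witnesses : set {ptws nat -> R} :=
  [set p | inequiv_witness (entry 0 ^~ p) (entry 1 ^~ p) (entry 2 ^~ p)
                           (entry 3 ^~ p)].

Lemma closed_coded_witnesses : closed coded_witnesses.
Proof. by apply: closed_inequiv_witness => n; exact: entry_continuous. Qed.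

Lemma pos_of_mul_ge1 (r s : R) : 0 <= r -> 1 <= s * r -> 0 < r.
Proof.
by rewrite le_eqVlt => /orP[/eqP<-|//]; rewrite mulr0 ler10.
Qed.

(** Makes the projection to (x, y) land in pairs of divergent sequences: [1 <= m n * x n] rules out
    [x n = 0], and likewise for y. *)
Lemma inequiv_witness_divergent (x y a m : nat -> R) :
  inequiv_witness x y a m -> divergent_seqs R x /\ divergent_seqs R y.
Proof.
move=> [_ pos [xm ym] _].
split; apply/divergent_seqsP; [|by exists m| |by exists m] => n.
  by have [[? ?] _] := pos n; exact: (@pos_of_mul_ge1 _ (m n)).
by have [_ [? ?]] := pos n; exact: (@pos_of_mul_ge1 _ (m n)).
Qed.

Lemma inequiv_witnessP (x y : divergent_seqs R) :
  ~ ideal_equiv x y <-> exists a m, inequiv_witness (val x) (val y) a m.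
Proof.
have [x0 xdiv] := set_valP x; have [y0 ydiv] := set_valP y.
have x0' n : 0 <= (val x : nat -> R) n := ltW (x0 n).
have y0' n : 0 <= (val y : nat -> R) n := ltW (y0 n).
split=> [xy|[a [m [a01 _ _ sep]]] xy]; last first.
  case: sep => sep.
    have [|A] := (separates_idealP x0' y0').2; first by exists a, m.
    by rewrite xy.
  have [|A] := (separates_idealP y0' x0').2; first by exists a, m.
  by rewrite xy.
have [m1 xm1] : exists m, diverges_at_rate m (val x).
  exact/(divergent_seqsP x0).
have [m2 ym2] : exists m, diverges_at_rate m (val y).
  exact/(divergent_seqsP y0).
have [a [m3 [a01 sep]]] : exists a m, (forall n, a n = 0 \/ a n = 1) /\
    (separates (val x) (val y) a m \/ separates (val y) (val x) a m).
  (* Distinct ideals fail one of the two inclusions; a set A showing this provides the indicator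
     a. *)
  have [xNy|yNx] : (exists2 A, summable_ideal (val x) A & ~ summable_ideal (val y) A)
                \/ (exists2 A, summable_ideal (val y) A & ~ summable_ideal (val x) A).
  - apply: contrapT => /not_orP[xNy yNx]; apply: xy; apply/seteqP.
    split=> A; apply: contraPP => Asum ?; [apply: xNy | apply: yNx];
      by exists A.
  - have [a [m [a01 sep]]] := (separates_idealP x0' y0').1 xNy.
    by exists a, m; split => //; left.
  - have [a [m [a01 sep]]] := (separates_idealP y0' x0').1 yNx.
    by exists a, m; split => //; right.
(* Every condition on m survives enlarging m, the terms of x and y being positive, so one sequence
   above both reciprocals and all three witnesses serves throughout. *)
pose m n := Num.max (((val x : nat -> R) n)^-1) (Num.max (((val y : nat -> R) n)^-1)
  (Num.max (m1 n) (Num.max (m2 n) (m3 n)))).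
have m1m n : m1 n <= m n by rewrite !le_max lexx !orbT.
have m2m n : m2 n <= m n by rewrite !le_max lexx !orbT.
have m3m n : m3 n <= m n by rewrite !le_max lexx !orbT.
have sepm u v : separates u v a m3 -> separates u v a m.
  move=> [um vm]; split=> [N|]; first exact: le_trans (um N) (m3m _).
  exact: diverges_at_rate_le vm.
exists a, m; split=> //.
- move=> n; split; split=> //.
    by rewrite -ler_pdivrMr// mul1r le_max lexx.
  by rewrite -ler_pdivrMr// mul1r !le_max lexx orbT.
- by split; [exact: diverges_at_rate_le xm1 | exact: diverges_at_rate_le ym2].
- by case: sep => /sepm; [left | right].
Qed.

Definition decode_fst (p : coded_witnesses) : divergent_seqs R :=
  SigSub (mem_set (inequiv_witness_divergent (set_valP p)).1).

Definition decode_snd (p : coded_witnesses) : divergent_seqs R :=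
  SigSub (mem_set (inequiv_witness_divergent (set_valP p)).2).

Lemma decode_fst_continuous : continuous decode_fst.
Proof.
apply: continuous_comp_initial => p.
apply/(pointwise_cvgP _ (fmap_filter _ (nbhs_filter p))) => n.
exact: (@coord_continuous _ _ (pickle (0, n)%N) p).
Qed.

Lemma decode_snd_continuous : continuous decode_snd.
Proof.
apply: continuous_comp_initial => p.
apply/(pointwise_cvgP _ (fmap_filter _ (nbhs_filter p))) => n.
exact: (@coord_continuous _ _ (pickle (1, n)%N) p).
Qed.

End Coding.

Theorem proposition1p2 (R : realType) :
  coanalytic R
    [set xy : divergent_seqs R * divergent_seqs R | ideal_equiv xy.1 xy.2].
Proof.
right; exists (set_type (@coded_witnesses R)).
exists (fun p => (decode_fst p, decode_snd p)); split.
- exact/polish_closed_subspace/closed_coded_witnesses.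
- move=> p; exact: (cvg_pair (FF := nbhs_filter p)
    (FG := nbhs_filter (decode_fst p)) (FH := nbhs_filter (decode_snd p))
    (@decode_fst_continuous R p) (@decode_snd_continuous R p)).
apply/seteqP; split=> [_ [p _ <-]|[x y] /inequiv_witnessP[a [m xyam]]] /=.
  apply/inequiv_witnessP; exists (entry 2 ^~ (val p)), (entry 3 ^~ (val p)).
  exact: set_valP p.
(* The default of [nth] supplies m as row 3 and as every later row. *)
pose s c := nth m [:: val x : nat -> R; val y : nat -> R; a] c.
have Kp : coded_witnesses (interleave s).
  rewrite /coded_witnesses/=.
  have sE c : (entry c ^~ (interleave s)) = s c.
    by apply/funext => n; rewrite entry_interleave.
  by rewrite !sE.
exists (SigSub (mem_set Kp)) => //; congr pair; apply: val_inj;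
  by apply/funext => n; exact: entry_interleave.
Qed.
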